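(* Let $\mathbf K\in\mathbb R^{N\times N}$ satisfy $\|\mathbf K\|_2=\kappa<1$, let $\boldsymbol\phi\in\mathbb R^N$, and let $\mathbf U\in\mathbb R^N$ be the solution of $(\mathbf I-\mathbf K)\mathbf U=\boldsymbol\phi$. Let $\mathcal R\in\mathbb R^{N\times r}$ have orthonormal columns and let $\widehat U=\mathcal R c$, $c\in\mathbb R^r$, be any reduced density. Define $$\mathbf r(\widehat U)=\boldsymbol\phi-(\mathbf I-\mathbf K)\widehat U,\qquad \Delta(\widehat U)=\frac{\|\mathbf r(\widehat U)\|_2}{1-\kappa}.$$ Then $$\frac{\|\mathbf r(\widehat U)\|_2}{1+\kappa}\le\|\mathbf U-\widehat U\|_2\le\Delta(\widehat U),$$ and hence, whenever $\mathbf U\ne\widehat U$, $$1\le\frac{\Delta(\widehat U)}{\|\mathbf U-\widehat U\|_2}\le\frac{1+\kappa}{1-\kappa}.$$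
   Context: $\|\cdot\|_2$ is the Euclidean norm on vectors and the induced operator norm on matrices. In the paper, $\mathbf K$ is the full-order discretization of a contractive second-kind Fredholm integral operator and $\kappa$ is its discrete contraction constant. *)

(* Defs.v *)
From mathcomp Require Import all_boot all_order all_algebra.
From mathcomp Require Import all_classical all_reals.
Set Implicit Arguments.
Unset Strict Implicit.
Unset Printing Implicit Defensive.
Import Order.TTheory GRing.Theory Num.Theory.
Local Open Scope classical_set_scope.
Local Open Scope ring_scope.

Definition dotv (R : realType) (n : nat) (x y : 'cV[R]_n) : R :=
  \sum_(i < n) x i 0 * y i 0.

Definition norm2 (R : realType) (n : nat) (x : 'cV[R]_n) : R :=
  Num.sqrt (dotv x x).

(* The set below contains 0 and is bounded above, so [sup] is its genuine
   supremum. The unit ball is used rather than the unit sphere because the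
   sphere is empty when n = 0. *)
Definition opnorm2 (R : realType) (m n : nat) (A : 'M[R]_(m, n)) : R :=
  sup [set norm2 (A *m x) | x in [set x : 'cV[R]_n | norm2 x <= 1]].

Definition orthonormal_columns (R : realType) (m n : nat)
    (Q : 'M[R]_(m, n)) : Prop :=
  forall i j : 'I_n, dotv (col i Q) (col j Q) = (i == j)%:R.

Definition residual (R : realType) (N : nat) (K : 'M[R]_N)
    (phi V : 'cV[R]_N) : 'cV[R]_N :=
  phi - (1%:M - K) *m V.

Definition error_bound (R : realType) (N : nat) (K : 'M[R]_N)
    (phi : 'cV[R]_N) (kappa : R) (V : 'cV[R]_N) : R :=
  norm2 (residual K phi V) / (1 - kappa).

(* Main.v *)
Require Import Defs.
From mathcomp Require Import all_boot all_order all_algebra.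
From mathcomp Require Import all_classical all_reals.
From mathcomp Require Import ring lra.
Import Order.TTheory GRing.Theory Num.Theory.
Local Open Scope ring_scope.

(** The residual of an approximation is the image of its error: with
    e = U - Uhat, linearity gives r = (I - K) e = e - K e.  Since
    |K e| <= kappa |e|, the triangle inequality gives both
    |r| <= (1 + kappa) |e| and |e| <= |r| + kappa |e|, which are the two
    bounds on the error; the bounds on their quotient follow by division.

    What has to be established is that [norm2] and [opnorm2] deserve their
    names.  The Cauchy-Schwarz inequality [dotv_cauchy_schwarz] yields the
    triangle inequality [norm2D], and also the bound of |A x| by the Frobenius
    norm of A times |x|.  The latter shows that the set defining [opnorm2 A] is
    bounded above, so that its supremum is an upper bound, and homogeneity
    then gives [norm2_mulmx]: |A x| <= opnorm2 A * |x|. *)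

Lemma dotvC (R : realType) n (x y : 'cV[R]_n) : dotv x y = dotv y x.
Proof. by apply: eq_bigr => i _; rewrite mulrC. Qed.

Lemma dotvDl (R : realType) n (x y z : 'cV[R]_n) :
  dotv (x + y) z = dotv x z + dotv y z.
Proof. by rewrite -big_split; apply: eq_bigr => i _; rewrite mxE mulrDl. Qed.

Lemma dotvZl (R : realType) n a (x y : 'cV[R]_n) :
  dotv (a *: x) y = a * dotv x y.
Proof. by rewrite mulr_sumr; apply: eq_bigr => i _; rewrite mxE mulrA. Qed.

Lemma dotvDr (R : realType) n (x y z : 'cV[R]_n) :
  dotv x (y + z) = dotv x y + dotv x z.
Proof. by rewrite dotvC dotvDl !(dotvC _ _ x). Qed.

Lemma dotvZr (R : realType) n a (x y : 'cV[R]_n) :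
  dotv x (a *: y) = a * dotv x y.
Proof. by rewrite dotvC dotvZl dotvC. Qed.

Lemma dotv_ge0 (R : realType) n (x : 'cV[R]_n) : 0 <= dotv x x.
Proof. by apply: sumr_ge0 => i _; rewrite -expr2 sqr_ge0. Qed.

Lemma dotv_eq0 (R : realType) n (x : 'cV[R]_n) : (dotv x x == 0) = (x == 0).
Proof.
apply/eqP/eqP => [/eqP|->]; last first.
  by apply: big1 => i _; rewrite mxE mul0r.
rewrite psumr_eq0 => [/allP x0|i _]; last by rewrite -expr2 sqr_ge0.
apply/colP => i; rewrite mxE; apply/eqP.
by have := x0 i (mem_index_enum i); rewrite mulf_eq0 orbb.
Qed.

Lemma dotv_cauchy_schwarz (R : realType) n (x y : 'cV[R]_n) :
  dotv x y ^+ 2 <= dotv x x * dotv y y.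
Proof.
have [->|y0] := eqVneq y 0.
  have d0 (z : 'cV[R]_n) : dotv z 0 = 0 by rewrite -(scale0r 0) dotvZr mul0r.
  by rewrite !d0 mulr0 expr0n.
have y_gt0 : 0 < dotv y y by rewrite lt_neqAle dotv_ge0 eq_sym dotv_eq0 y0.
(* This vector is |y|^2 times the component of x orthogonal to y. *)
have := dotv_ge0 _ _ (dotv y y *: x + (- dotv x y) *: y).
rewrite !(dotvDl, dotvDr, dotvZl, dotvZr) (dotvC _ _ y x) => h.
rewrite -subr_ge0 -(pmulr_rge0 _ y_gt0); apply: le_trans h _.
by rewrite le_eqVlt; apply/orP; left; apply/eqP; ring.
Qed.

Lemma norm2_ge0 (R : realType) n (x : 'cV[R]_n) : 0 <= norm2 x.
Proof. exact: sqrtr_ge0. Qed.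

Lemma sqr_norm2 (R : realType) n (x : 'cV[R]_n) : norm2 x ^+ 2 = dotv x x.
Proof. by rewrite sqr_sqrtr ?dotv_ge0. Qed.

Lemma norm2_eq0 (R : realType) n (x : 'cV[R]_n) : (norm2 x == 0) = (x == 0).
Proof. by rewrite -dotv_eq0 -sqr_norm2 sqrf_eq0. Qed.

Lemma norm20 (R : realType) n : norm2 (0 : 'cV[R]_n) = 0.
Proof. by apply/eqP; rewrite norm2_eq0. Qed.

Lemma norm2Z (R : realType) n a (x : 'cV[R]_n) : norm2 (a *: x) = `|a| * norm2 x.
Proof. by rewrite /norm2 dotvZl dotvZr mulrA -expr2 sqrtrM ?sqr_ge0// sqrtr_sqr. Qed.

Lemma norm2N (R : realType) n (x : 'cV[R]_n) : norm2 (- x) = norm2 x.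
Proof. by rewrite -scaleN1r norm2Z normrN1 mul1r. Qed.

Lemma norm2D (R : realType) n (x y : 'cV[R]_n) :
  norm2 (x + y) <= norm2 x + norm2 y.
Proof.
have dxy : dotv x y <= norm2 x * norm2 y.
  apply: le_trans (ler_norm _) _.
  rewrite -sqrtr_sqr -sqrtrM ?dotv_ge0//.
  exact/ler_wsqrtr/dotv_cauchy_schwarz.
rewrite -(@ler_pXn2r _ 2) ?nnegrE ?addr_ge0 ?norm2_ge0//.
rewrite sqrrD !sqr_norm2 dotvDl !dotvDr (dotvC _ _ y x); lra.
Qed.

(** The constant is the Frobenius norm of [A]. *)
Lemma norm2_mulmx_frobenius (R : realType) m n (A : 'M[R]_(m, n)) (x : 'cV[R]_n) :
  norm2 (A *m x) <=
  Num.sqrt (\sum_i dotv (row i A)^T (row i A)^T) * norm2 x.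
Proof.
rewrite -sqrtrM; last by apply: sumr_ge0 => i _; exact: dotv_ge0.
apply: ler_wsqrtr; rewrite mulr_suml; apply: ler_sum => i _.
rewrite -expr2; apply: le_trans (dotv_cauchy_schwarz _ _ _ _).
rewrite le_eqVlt; apply/orP; left; apply/eqP; congr (_ ^+ 2).
by rewrite mxE; apply: eq_bigr => j _; rewrite !mxE.
Qed.

Lemma norm2_le_opnorm2 (R : realType) m n (A : 'M[R]_(m, n)) (x : 'cV[R]_n) :
  norm2 x <= 1 -> norm2 (A *m x) <= opnorm2 A.
Proof.
move=> x1; apply: ub_le_sup; last by exists x.
exists (Num.sqrt (\sum_i dotv (row i A)^T (row i A)^T)) => _ [y /= y1 <-].
apply: le_trans (norm2_mulmx_frobenius _ _ _ _ _) _.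
by rewrite ler_piMr ?sqrtr_ge0.
Qed.

Lemma opnorm2_ge0 (R : realType) m n (A : 'M[R]_(m, n)) : 0 <= opnorm2 A.
Proof.
apply: le_trans (norm2_ge0 _ _ (A *m 0)) _.
by apply: norm2_le_opnorm2; rewrite norm20.
Qed.

Lemma norm2_mulmx (R : realType) m n (A : 'M[R]_(m, n)) (x : 'cV[R]_n) :
  norm2 (A *m x) <= opnorm2 A * norm2 x.
Proof.
have [->|x0] := eqVneq x 0; first by rewrite mulmx0 !norm20 mulr0.
have nx_gt0 : 0 < norm2 x by rewrite lt_neqAle norm2_ge0 eq_sym norm2_eq0 x0.
have := norm2_le_opnorm2 _ _ _ A ((norm2 x)^-1 *: x).
rewrite -scalemxAr !norm2Z ger0_norm ?invr_ge0 ?norm2_ge0// mulVf ?gt_eqF//.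
by move=> /(_ (lexx _)); rewrite mulrC ler_pdivrMr.
Qed.

Lemma residualE (R : realType) N (K : 'M[R]_N) (phi U V : 'cV[R]_N) :
  (1%:M - K) *m U = phi -> residual K phi V = (U - V) - K *m (U - V).
Proof. by move=> <-; rewrite /residual -mulmxBr mulmxBl mul1mx. Qed.

Theorem theorem3p5 (R : realType) (N r : nat) (K : 'M[R]_N) (kappa : R)
    (phi U : 'cV[R]_N) (Q : 'M[R]_(N, r)) (c : 'cV[R]_r) (Uhat : 'cV[R]_N)
    (hK : opnorm2 K = kappa) (hkappa : kappa < 1)
    (hU : (1%:M - K) *m U = phi)
    (hQ : orthonormal_columns Q)
    (hUhat : Uhat = Q *m c) :
  (norm2 (residual K phi Uhat) / (1 + kappa) <= norm2 (U - Uhat) /\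
   norm2 (U - Uhat) <= error_bound K phi kappa Uhat) /\
  (U <> Uhat ->
   1 <= error_bound K phi kappa Uhat / norm2 (U - Uhat) /\
   error_bound K phi kappa Uhat / norm2 (U - Uhat)
     <= (1 + kappa) / (1 - kappa)).
Proof.
have kappa_ge0 : 0 <= kappa by rewrite -hK opnorm2_ge0.
rewrite /error_bound (residualE _ _ _ _ _ _ hU).
have := norm2_mulmx _ _ _ K (U - Uhat); rewrite hK.
have : U <> Uhat -> 0 < norm2 (U - Uhat).
  by move=> /eqP ne; rewrite lt_neqAle norm2_ge0 eq_sym norm2_eq0 subr_eq0 ne.
move: (U - Uhat) => e e_gt0 Ke.
have res_le : norm2 (e - K *m e) <= norm2 e + norm2 (K *m e).
  by rewrite -(norm2N _ _ (K *m e)) norm2D.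
have err_le : norm2 e <= norm2 (e - K *m e) + norm2 (K *m e).
  by rewrite -{1}(subrK (K *m e) e) norm2D.
have kD_gt0 : 0 < 1 + kappa by lra.
have kB_gt0 : 0 < 1 - kappa by lra.
have lower : norm2 (e - K *m e) <= (1 + kappa) * norm2 e by lra.
have upper : norm2 e <= norm2 (e - K *m e) / (1 - kappa).
  by rewrite ler_pdivlMr//; lra.
split; first by split=> //; rewrite ler_pdivrMr// mulrC.
move=> /e_gt0 ne_gt0; split; first by rewrite ler_pdivlMr// mul1r.
by rewrite ler_pdivrMr// mulrAC ler_pM2r ?invr_gt0.
Qed.
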